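(* There exist a finite connected graph $G$, a variance-optimal function $X$ over $G$, and sequences $(d_n)_{n\ge1}$ of positive integers and $(r_n)_{n\ge 1}$ of real numbers with $d_n/\sqrt{n}\to\infty$, $d_n/n\to 0$ and $|S_{r_n}|\ge \frac12|V(G^n)|$ for all $n$, where $$S_{r_n}=\Big\{(a_1,\ldots,a_n)\in V(G^n): \sum_{i=1}^n X(a_i)\le r_n\Big\},$$ such that for infinitely many $n$ there is a set $S'\subseteq V(G^n)$ with $|S_{r_n}|\le |S'|$ and $|B_{d_n}(S')|<|B_{d_n}(S_{r_n})|$. That is, the following conjecture of Alon, Boppana and Spencer is not true: if $X$ is variance-optimal over $G$, then for $n$ sufficiently large and $d,r$ in appropriate ranges, $|B_d(S_r)|\le|B_d(S')|$ for all $S'\subset V(G^n)$ with $|S_r|\le|S'|$.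
   Context: A function $X:V(G)\to\mathbb{R}$ is Lipschitz if $|X(u)-X(v)|\le d_G(u,v)$ for all vertices $u,v$, where $d_G$ is the graph distance; it is treated as a random variable by placing the uniform distribution on $V(G)$. It is variance-optimal if it is Lipschitz and has maximum variance among all Lipschitz functions on $V(G)$. $G^n$ is the $n$-fold Cartesian product of $G$: its vertex set is $V(G)^n$ and the distance between $(v_1,\ldots,v_n)$ and $(u_1,\ldots,u_n)$ is $\sum_i d_G(v_i,u_i)$. For a set $S$ of vertices of $G^n$, $B_d(S)=\{u: d_{G^n}(u,S)\le d\}$. *)

(* Defs.v *)
From HB Require Import structures.
From mathcomp Require Import all_boot all_order all_algebra.
From mathcomp Require Import all_classical all_reals all_analysis.

Set Implicit Arguments.
Unset Strict Implicit.
Unset Printing Implicit Defensive.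

Import Order.TTheory GRing.Theory Num.Theory numFieldNormedType.Exports.

Local Open Scope ring_scope.

Definition simple_graph (T : finType) (e : rel T) : Prop :=
  symmetric e /\ irreflexive e.

Definition connected_graph (T : finType) (e : rel T) : Prop :=
  (0 < #|T|)%N /\ forall u v : T, connect e u v.

Definition has_walk (T : finType) (e : rel T) (u v : T) (k : nat) : bool :=
  [exists p : k.-tuple T, path e u p && (last u p == v)].

(* The least k < #|T| such that some walk from u to v has k edges. In a
   connected graph there is one (lemma gdistP); when v is not reachable
   from u the value is the junk #|T|. *)
Definition gdist (T : finType) (e : rel T) (u v : T) : nat :=
  find (has_walk e u v) (iota 0 #|T|).

Lemma has_walkP (T : finType) (e : rel T) (u v : T) (k : nat) :
  reflect (exists p : seq T, [/\ path e u p, last u p = v & size p = k])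
          (has_walk e u v k).
Proof.
apply: (iffP existsP) => [[p /andP[ep /eqP lp]]|[p [ep lp sp]]].
  by exists p; rewrite size_tuple.
by exists (tcast sp (in_tuple p)); rewrite val_tcast /= ep lp eqxx.
Qed.

Lemma gdistP (T : finType) (e : rel T) (u v : T) : connect e u v ->
  has_walk e u v (gdist e u v) /\
  forall k : nat, has_walk e u v k -> (gdist e u v <= k)%N.
Proof.
move=> /connectP[p0 /shortenP[p ep up _] lp].
have sp : (size p < #|T|)%N by have /= <- := card_uniqP up; apply: max_card.
have wp : has_walk e u v (size p) by apply/has_walkP; exists p.
have hs : has (has_walk e u v) (iota 0 #|T|).
  by apply/hasP; exists (size p); rewrite ?mem_iota.
have lt : (gdist e u v < #|T|)%N by rewrite -(size_iota 0 #|T|) -has_find.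
split; first by have := nth_find 0%N hs; rewrite nth_iota.
move=> k wk; rewrite leqNgt; apply/negP => lk.
have := before_find 0%N lk; rewrite nth_iota ?add0n ?wk //.
exact: ltn_trans lk lt.
Qed.

Definition lipschitz_fun (R : realType) (T : finType) (e : rel T)
    (X : T -> R) : Prop :=
  forall u v : T, `|X u - X v| <= (gdist e u v)%:R.

Definition unif_mean (R : realType) (T : finType) (X : T -> R) : R :=
  (\sum_(v : T) X v) / #|T|%:R.

Definition unif_variance (R : realType) (T : finType) (X : T -> R) : R :=
  unif_mean (fun v => (X v - unif_mean X) ^+ 2).

Definition variance_optimal (R : realType) (T : finType) (e : rel T)
    (X : T -> R) : Prop :=
  lipschitz_fun e X /\
  forall Y : T -> R, lipschitz_fun e Y -> unif_variance Y <= unif_variance X.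

Definition pow_vertices (T : finType) (n : nat) : finType := {ffun 'I_n -> T}.

Definition pow_dist (T : finType) (e : rel T) (n : nat)
    (u v : pow_vertices T n) : nat :=
  (\sum_(i < n) gdist e (u i) (v i))%N.

(* For A nonempty, "some v in A has distance at most k from u" says that
   the minimum distance from u to A is at most k; the ball of the empty set
   is empty. *)
Definition pow_ball (T : finType) (e : rel T) (n k : nat)
    (A : {set pow_vertices T n}) : {set pow_vertices T n} :=
  [set u | [exists v in A, (pow_dist e u v <= k)%N]]%SET.

Definition sum_sublevel (R : realType) (T : finType) (X : T -> R) (n : nat)
    (r : R) : {set pow_vertices T n} :=
  [set a : pow_vertices T n | \sum_(i < n) X (a i) <= r]%SET.

(* Main.v *)
Require Import Defs.
From HB Require Import structures.
From mathcomp Require Import all_boot all_order all_algebra.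
From mathcomp Require Import all_classical all_reals all_analysis.
From mathcomp Require Import zify ring lra.

(** Take [G = K_3], with [X] the indicator of two of the three vertices, so
that the sum of [X] over the coordinates is the Hamming weight, and take for
[S_r] the words of weight less than [n - d].  Then [B_d(S_r)] misses exactly
the [2^n] words without zero.  Compare with the complement [S'] of the Hamming
ball of radius [x + d] around [0], where [x] is minimal such that the ball
[V(x)] of radius [x] has more than [2^n] elements; [B_d(S')] misses [V(x)].
Since [x] exceeds [n / 5], adding one to the radius multiplies the volume by at
most 11, hence [|V(x + d)| <= 11^(d+1) 2^n].  The complement of [S_r] has at least
['C(n, d) 2^(n-d) >= (n / 2d)^d 2^n] elements, which is more as soon as [d] is
a small enough fraction of [n]; so [|S_r| <= |S'|]. *)

Set Implicit Arguments.
Unset Strict Implicit.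
Unset Printing Implicit Defensive.

Import Order.TTheory GRing.Theory Num.Theory numFieldNormedType.Exports.

Local Open Scope classical_set_scope.
Local Open Scope ring_scope.

(** * The graph [K_3] and its variance-optimal function *)

Definition complete_rel (T : finType) : rel T := fun u v => u != v.

Lemma simple_complete (T : finType) : simple_graph (@complete_rel T).
Proof. by split=> [u v|u]; rewrite /complete_rel ?eqxx // eq_sym. Qed.

Lemma connect_complete (T : finType) (u v : T) : connect (@complete_rel T) u v.
Proof. by have [->|uv] := eqVneq u v; [exact: connect0 | exact: connect1]. Qed.

Lemma gdist_complete (T : finType) (u v : T) :
  gdist (@complete_rel T) u v = (u != v).
Proof.
have [/has_walkP[p [_ lp sp]] min_d] := gdistP (connect_complete u v).
have [uv|uv] := eqVneq u v.
  apply/eqP; rewrite -leqn0; apply: min_d.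
  by apply/has_walkP; exists [::]; rewrite uv.
apply/eqP; rewrite eqn_leq min_d /=; last first.
  by apply/has_walkP; exists [:: v]; rewrite /= /complete_rel uv.
rewrite lt0n -sp; case: p lp {sp} => //= uv'.
by rewrite uv' eqxx in uv.
Qed.

Definition nonzero_ind (R : realType) (v : 'I_3) : R := (v != ord0)%:R.

Lemma lipschitz_nonzero_ind (R : realType) :
  lipschitz_fun (@complete_rel _) (@nonzero_ind R).
Proof.
move=> u v; rewrite gdist_complete /nonzero_ind.
have [->|uv] := eqVneq u v; first by rewrite subrr normr0.
by case: (u != _); case: (v != _);
  rewrite ?subrr ?subr0 ?sub0r ?normrN ?normr0 ?normr1.
Qed.

(** The variance is the sum of squared differences over unordered pairs, divided by the squared
    number of points; the Lipschitz condition bounds exactly these differences. *)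
Lemma unif_variance3 (R : realType) (X : 'I_3 -> R) :
  let a := X ord0 in let b := X (lift ord0 ord0) in let c := X ord_max in
  unif_variance X = ((a - b) ^+ 2 + (b - c) ^+ 2 + (c - a) ^+ 2) / 9.
Proof.
rewrite /unif_variance /unif_mean card_ord !big_ord_recl !big_ord0 /=.
rewrite (_ : lift ord0 (lift ord0 ord0) = ord_max); last exact: val_inj.
by field.
Qed.

(** The differences sum to zero, so the largest in absolute value is, up to sign, [p + q] with [p]
    and [q] of equal sign the other two, and [p^2 + q^2 <= (p + q)^2 <= 1]. *)
Lemma sum_sqr_sides_le2 (R : realType) (a b c : R) :
  `|a - b| <= 1 -> `|b - c| <= 1 -> `|c - a| <= 1 ->
  (a - b) ^+ 2 + (b - c) ^+ 2 + (c - a) ^+ 2 <= 2.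
Proof.
rewrite !ler_norml => /andP[? ?] /andP[? ?] /andP[? ?].
by case: (lerP a b) => ?; case: (lerP b c) => ?; case: (lerP c a) => ?; nra.
Qed.

Lemma variance_optimal_nonzero_ind (R : realType) :
  variance_optimal (@complete_rel _) (@nonzero_ind R).
Proof.
split=> [|Y lipY]; first exact: lipschitz_nonzero_ind.
rewrite !unif_variance3 ler_pM2r ?invr_gt0 ?ltr0n //.
rewrite [leRHS](_ : _ = 2); last first.
  have -> : nonzero_ind R ord0 = 0 by [].
  have -> : nonzero_ind R ord_max = 1 by [].
  have -> : nonzero_ind R (lift ord0 ord0) = 1 by [].
  by ring.
by apply: sum_sqr_sides_le2; apply: le_trans (lipY _ _) _;
  rewrite gdist_complete.
Qed.

Lemma leq_exp2rW (m n k : nat) : (m <= n -> m ^ k <= n ^ k)%N.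
Proof. by case: k => // k mn; rewrite leq_exp2r. Qed.

(** Induction through [d.+1 * 'C(n, d.+1) = n * 'C(n.-1, d)]: here [n >= c * d.+1], and
    [n.-1 >= c * d] once [c > 0]. *)
Lemma leq_exp_bin (c n d : nat) : (c * d <= n -> c ^ d <= 'C(n, d))%N.
Proof.
elim: d n => [|d IHd] n cdn; first by rewrite bin0.
case: c => [|c] in IHd cdn *; first by rewrite exp0n.
rewrite -(leq_pmul2l (ltn0Sn d)) -mul_bin_diag expnS mulnCA mulnA.
by apply: leq_mul; [lia | apply: IHd; lia].
Qed.

(** * Hamming weight of words over three letters *)

Section Weight.
Local Open Scope set_scope.
Local Open Scope nat_scope.
Variable n : nat.
Implicit Types a u v : pow_vertices 'I_3 n.

Definition wt a : nat := \sum_(i < n) (a i != ord0).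

Lemma wt_le a : wt a <= n.
Proof.
rewrite -[X in _ <= X]card_ord -sum1_card; apply: leq_sum => i _.
exact: leq_b1.
Qed.

Lemma wt_card a : wt a = #|[set i | a i != ord0]|.
Proof. by rewrite /wt -big_mkcond sum1dep_card. Qed.

Lemma wt_leD u v : wt v <= wt u + pow_dist (@complete_rel _) u v.
Proof.
rewrite /wt /pow_dist -big_split /=; apply: leq_sum => i _.
rewrite gdist_complete; have [->|_] := eqVneq (u i) (v i).
  exact: leq_addr.
exact: leq_trans (leq_b1 _) (leq_addl _ _).
Qed.

(** Turning a nonzero letter into zero costs distance one and lowers the weight by one, as long as
    such a letter is left. *)
Lemma wt_descend u k :
  exists v, pow_dist (@complete_rel _) u v <= k /\ wt v <= wt u - k.
Proof.
elim: k => [|k [v [dv wv]]].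
  exists u; rewrite subn0; split=> //; rewrite leqn0 /pow_dist big1 // => i _.
  by rewrite gdist_complete eqxx.
have [/existsP[i vi]|/existsPn v0] := boolP [exists i, v i != ord0]; last first.
  exists v; split; first exact: leqW.
  by rewrite /wt big1 // => i _; rewrite (negPf (v0 i)).
exists [ffun j => if j == i then ord0 else v j]; split.
  rewrite /pow_dist (bigD1 i) //= -[k.+1]add1n; apply: leq_add.
    by rewrite gdist_complete leq_b1.
  apply: leq_trans dv; rewrite /pow_dist [X in _ <= X](bigD1 i) //=.
  apply: leq_trans (leq_addl _ _); apply: leq_sum => j ji.
  by rewrite ffunE (negPf ji).
suff : wt [ffun j => if j == i then ord0 else v j] < wt v by lia.
rewrite /wt [X in _ < X](bigD1 i) //= vi add1n ltnS (bigD1 i) //= ffunE eqxx.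
rewrite add0n; apply: leq_sum => j ji.
by rewrite ffunE (negPf ji).
Qed.

Lemma card_pow_vertices : #|pow_vertices 'I_3 n| = 3 ^ n.
Proof. by rewrite card_ffun !card_ord. Qed.

Lemma card_support (A : {set 'I_n}) :
  #|[set a : pow_vertices 'I_3 n | [set i | a i != ord0] == A]| = 2 ^ #|A|.
Proof.
pose F i := [pred t : 'I_3 | (t != ord0) == (i \in A)].
have -> : #|[set a : pow_vertices 'I_3 n | [set i | a i != ord0] == A]|
  = #|family F|.
  apply: eq_card => a; rewrite inE; apply/eqP/familyP => [eA i|aF].
    by rewrite inE -eA inE.
  by apply/setP => i; rewrite inE; have /eqP := aF i.
rewrite card_family foldrE big_map big_enum /=.
rewrite (bigID (mem A)) /= [X in _ * X]big1 ?muln1 => [|i /negPf iA].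
  rewrite -prod_nat_const; apply: eq_bigr => i iA.
  rewrite (eq_card (B := predC1 ord0)) => [|t]; last first.
    by rewrite /= iA unfold_in !inE; case: (t != ord0).
  by rewrite cardC1 card_ord.
rewrite (eq_card (B := pred1 ord0)) ?card1 // => t.
by rewrite /= iA unfold_in !inE; case: (t == ord0).
Qed.

Lemma card_wt_eq y :
  #|[set a : pow_vertices 'I_3 n | wt a == y]| = 'C(n, y) * 2 ^ y.
Proof.
rewrite -sum1dep_card.
rewrite (partition_big (fun a => [set i | a i != ord0])
           (fun A : {set 'I_n} => #|A| == y)) /= => [|a]; last first.
  by rewrite wt_card.
rewrite -[X in 'C(X, y)]card_ord -card_draws -sum_nat_const.
rewrite [RHS](eq_bigl (fun A : {set 'I_n} => #|A| == y)); last first.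
  by move=> A; rewrite inE.
apply: eq_bigr => A /eqP cA; rewrite -cA -card_support -sum1dep_card.
apply: eq_bigl => a; case: (_ =P A) => [eA|_]; last by rewrite andbF.
by rewrite wt_card eA eqxx.
Qed.

(** The generating function of the weight factors over the coordinates; it feeds the exponential
    Markov bounds below. *)
Lemma sum_prod_weight (p q : nat) :
  \sum_a p ^ (n - wt a) * q ^ wt a = (p + 2 * q) ^ n.
Proof.
have -> : p + 2 * q = \sum_(t : 'I_3) (if t == ord0 then p else q).
  by rewrite !big_ord_recl big_ord0 /= addn0 mul2n addnn.
rewrite -[X in _ ^ X]card_ord -prod_nat_const bigA_distr_bigA /=.
apply: eq_bigr => a _; rewrite (bigID (fun i => a i == ord0)) /=.
have wtE : wt a = #|[pred i | a i != ord0]| by rewrite wt_card cardsE.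
have -> : n - wt a = #|[pred i | a i == ord0]|.
  have := cardC [pred i | a i == ord0]; rewrite card_ord.
  rewrite (eq_card (A := [predC _]) (B := [pred i | a i != ord0])) // -wtE.
  by move/(canRL (addnK _)).
rewrite wtE -!prod_nat_const; congr (_ * _); apply: eq_bigr => i.
  by rewrite inE => ->.
by rewrite inE => /negPf ->.
Qed.

(** * Volumes of Hamming balls *)

Definition wt_ball y := [set a : pow_vertices 'I_3 n | wt a <= y].

Lemma card_wt_ballS y :
  #|wt_ball y.+1| = #|wt_ball y| + 'C(n, y.+1) * 2 ^ y.+1.
Proof.
rewrite -card_wt_eq -cardsUI [X in _ + X]eq_card0 => [|a]; last first.
  by rewrite !inE; lia.
by rewrite addn0; apply: eq_card => a; rewrite !inE; lia.
Qed.

(** Consecutive spheres have ratio [2 (n - y) / (y + 1) <= 10], and the sphere of radius [y] lies in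
    the ball. *)
Lemma card_wt_ball_step y :
  n <= 5 * y.+1 -> #|wt_ball y.+1| <= 11 * #|wt_ball y|.
Proof.
move=> ny.
have /subset_leq_card :
    [set a : pow_vertices 'I_3 n | wt a == y] \subset wt_ball y.
  by apply/fintype.subsetP => a; rewrite !inE => /eqP ->.
rewrite card_wt_ballS card_wt_eq => h.
suff : 'C(n, y.+1) * 2 ^ y.+1 <= 10 * ('C(n, y) * 2 ^ y) by lia.
have binS : y.+1 * 'C(n, y.+1) = (n - y) * 'C(n, y) by rewrite mul_bin_left.
rewrite -(leq_pmul2l (ltn0Sn y)) mulnA binS expnS.
have : n - y <= 5 * y.+1 by lia.
by move: (2 ^ y) ('C(n, y)) => p c; nia.
Qed.

Lemma card_wt_ball_iter y k :
  n <= 5 * y.+1 -> #|wt_ball (y + k)| <= 11 ^ k * #|wt_ball y|.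
Proof.
move=> ny; elim: k => [|k IHk]; first by rewrite addn0 mul1n.
rewrite addnS expnS -mulnA.
apply: leq_trans (_ : _ <= 11 * #|wt_ball (y + k)|) _.
  by apply: card_wt_ball_step; lia.
by rewrite leq_mul2l.
Qed.

(* Exponential Markov inequality with weights 4 for zero, 1 for nonzero. *)
Lemma card_wt_ball_small y : 5 * y <= n -> #|wt_ball y| <= 2 ^ n.
Proof.
move=> yn.
have : #|wt_ball y| * 4 ^ (n - y) <= 6 ^ n.
  rewrite -(sum_prod_weight 4 1) -sum_nat_const.
  rewrite [X in _ <= X](bigID (mem (wt_ball y))) /=.
  apply: leq_trans (leq_addr _ _); apply: leq_sum => a.
  by rewrite inE exp1n muln1 => ay; rewrite leq_exp2l //; lia.
(* The fraction [1/5] works because [3^5 = 243 <= 256 = 4^4]. *)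
have : 3 ^ n <= 4 ^ (n - y).
  have -> : n - y = 4 * y + (n - 5 * y) by lia.
  rewrite -{1}(subnKC yn) (expnD 3) (expnD 4) (expnM 3) (expnM 4).
  by apply: leq_mul; apply: leq_exp2rW.
move=> h1 h2; rewrite -(leq_pmul2r (expn_gt0 4 (n - y))) //.
by apply: leq_trans h2 _; rewrite -[6]/(2 * 3) expnMn leq_mul2l h1 orbT.
Qed.

(* Exponential Markov inequality with weights 1 for zero, 2 for nonzero. *)
Lemma card_wt_co_ball_half d : 8 * d <= n -> 0 < d ->
  2 * #|[set a : pow_vertices 'I_3 n | n - d <= wt a]| <= 3 ^ n.
Proof.
move=> dn d0; set B := [set a | _].
have : #|B| * 2 ^ (n - d) <= 5 ^ n.
  rewrite -(sum_prod_weight 1 2) -sum_nat_const [X in _ <= X](bigID (mem B)) /=.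
  apply: leq_trans (leq_addr _ _); apply: leq_sum => a.
  by rewrite inE exp1n mul1n => ay; rewrite leq_exp2l.
(* Raise [2 * 5^4 = 1250 <= 1296 = 6^4] to the power [2 d]; since [d > 0], [d + 1 <= 2 d]. *)
have : 2 ^ d.+1 * 5 ^ n <= 6 ^ n.
  have -> : n = 4 * (d + d) + (n - 8 * d) by lia.
  rewrite (expnD 5) (expnD 6) mulnA; apply: leq_mul; last exact: leq_exp2rW.
  apply: (@leq_trans (2 ^ (d + d) * 5 ^ (4 * (d + d)))).
    by rewrite leq_mul2r leq_exp2l //; lia.
  rewrite (expnM 5) (expnM 6) -expnMn; exact: leq_exp2rW.
have -> : 6 ^ n = 3 ^ n * 2 ^ (n - d) * 2 ^ d.
  by rewrite -mulnA -expnD subnK -?(expnMn 3 2) //; lia.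
rewrite expnS => h1 h2.
rewrite -(leq_pmul2r (expn_gt0 2 (n - d))) // -(leq_pmul2r (expn_gt0 2 d)) //.
apply: leq_trans h1; move: h2.
by move: (2 ^ d) (2 ^ (n - d)) (5 ^ n) => p q s h; nia.
Qed.

(** * Neighbourhoods of the two competing sets *)

(** A word with a zero has weight at most [n - 1], so zeroing up to [d] letters brings it below
    [n - d > 0]. Only the [2^n] words of full weight can be missed. *)
Lemma pow_ball_sublevel d (A : {set pow_vertices 'I_3 n}) :
  d < n -> (forall a, wt a < n - d -> a \in A) ->
  3 ^ n <= #|pow_ball (@complete_rel _) d A| + 2 ^ n.
Proof.
move=> dn subA.
have := card_wt_eq n; rewrite binn mul1n => <-.
rewrite -card_pow_vertices -cardsT; apply: leq_trans (leq_card_setU _ _).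
apply: subset_leq_card; apply/fintype.subsetP => u _; rewrite !inE.
have [//|un] := eqVneq (wt u) n; first by rewrite orbT.
rewrite orbF; apply/existsP; have [v [dv wv]] := wt_descend u d.
exists v; rewrite dv andbT; apply: subA.
by have := wt_le u; lia.
Qed.

Lemma exists_small_expansion d : 0 < d -> 242 * d <= n ->
  exists S' : {set pow_vertices 'I_3 n},
    #|[set a : pow_vertices 'I_3 n | wt a < n - d]| <= #|S'| /\
    #|pow_ball (@complete_rel _) d S'| + 2 ^ n < 3 ^ n.
Proof.
move=> d0 dn.
have exx : exists x, 2 ^ n < #|wt_ball x|.
  exists n; rewrite (_ : wt_ball n = [set: _]%SET) ?cardsT ?card_pow_vertices.
    by rewrite ltn_exp2r //; lia.
  by apply/setP => a; rewrite !inE wt_le.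
have [x xV xmin] := ex_minnP exx.
have nx : n < 5 * x.
  by rewrite ltnNge; apply/negP => /card_wt_ball_small; rewrite leqNgt xV.
case: x => [|y] in xV xmin nx *; first by lia.
have yV : #|wt_ball y| <= 2 ^ n.
  by rewrite leqNgt; apply/negP => /xmin; rewrite ltnn.
exists (~: wt_ball (y.+1 + d)); split.
  rewrite -(leq_add2l #|wt_ball (y.+1 + d)|) cardsC card_pow_vertices.
  have := cardsC [set a : pow_vertices 'I_3 n | wt a < n - d].
  rewrite card_pow_vertices => <-.
  (* By minimality the ball of radius [y] has at most [2^n] elements, so the growth is counted from
     [y], in [d + 1] steps. *)
  rewrite addnC leq_add2l addSnnS.
  apply: leq_trans (card_wt_ball_iter _ (ltnW nx)) _.
  (* The single sphere of weight [n - d] is already large enough. *)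
  apply: (@leq_trans #|[set a : pow_vertices 'I_3 n | wt a == n - d]|).
    rewrite card_wt_eq bin_sub; last by lia.
    apply: leq_trans (_ : _ <= 242 ^ d * 2 ^ (n - d)) _; last first.
      by rewrite leq_mul2r leq_exp_bin ?orbT.
    apply: leq_trans (leq_mul (leqnn _) yV) _.
    rewrite -(@subnKC d n) ?addKn ?expnD ?mulnA; last by lia.
    (* In [242 = 11^2 * 2], the power [11^(2 d)] absorbs [11^(d + 1)], and [2^d] completes
       [2^(n - d)] to [2^n]. *)
    rewrite leq_mul2r (_ : 242 = 11 * 11 * 2) // !(expnMn _ _ d) leq_mul2r.
    by rewrite -expnD leq_exp2l // ; apply/orP; right; apply/orP; right; lia.
  by apply: subset_leq_card; apply/fintype.subsetP => a; rewrite !inE; lia.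
have := cardsC (wt_ball y.+1); rewrite card_pow_vertices => <-.
rewrite addnC -addSn; apply: leq_add; first exact: xV.
apply: subset_leq_card; apply/fintype.subsetP => u; rewrite !inE => /existsP[v].
by rewrite !inE -!ltnNge => /andP[vw dv]; have := wt_leD u v; lia.
Qed.

End Weight.

(** * A radius between [sqrt n] and [n] *)

Section Radius.
Local Open Scope nat_scope.

(* With [k = 2 ^ logscale n], one has [k ^ 4 <= n], so that the radius [n / k]
lies well between [sqrt n] and [n]. *)
Definition logscale (n : nat) : nat := trunc_log 16 n.
Definition radius (n : nat) : nat := n %/ 2 ^ logscale n.

Lemma logscale_ge A n : 16 ^ A <= n -> A <= logscale n.
Proof. by move=> h; apply: trunc_log_max. Qed.

Lemma logscale_bound n : 0 < n -> (2 ^ logscale n) ^ 4 <= n.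
Proof.
by move=> n0; rewrite -expnM mulnC expnM; apply: trunc_logP.
Qed.

Lemma radius_gt0 n : 0 < n -> 0 < radius n.
Proof.
move=> n0; rewrite divn_gt0 ?expn_gt0 //; apply: leq_trans (logscale_bound n0).
by rewrite -{1}[2 ^ _]expn1 leq_pexp2l // expn_gt0.
Qed.

Lemma radius_le n : radius n * 2 ^ logscale n <= n.
Proof. exact: leq_divM. Qed.

(** The quotient [q] is at least 1, so [n < (q + 1) k <= 2 q k]. *)
Lemma radius_ge n : 0 < n -> n <= 2 * radius n * 2 ^ logscale n.
Proof.
move=> n0; have := radius_gt0 n0; rewrite /radius; set k := 2 ^ _ => d0.
have : n < (n %/ k).+1 * k by rewrite -ltn_divLR // expn_gt0.
by move: (n %/ k) d0 => q; nia.
Qed.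

End Radius.

Lemma logscale_unbounded (R : realType) (A : R) :
  \forall n \near \oo, A <= (2 ^ logscale n)%:R.
Proof.
have AM := archi_boundP (normr_ge0 A).
exists (16 ^ Num.bound `|A|)%N => // n /= /logscale_ge Mn.
apply: le_trans (ler_norm A) _; apply: le_trans (ltW AM) _.
by rewrite ler_nat; apply: leq_trans Mn _; apply: ltnW; apply: ltn_expl.
Qed.

(** With [s = sqrt n], [2 d k >= s^2 >= k^2 s], so [d / s >= k / 2], which is unbounded. *)
Lemma cvg_radius_sqrt (R : realType) :
  (fun n : nat => (radius n)%:R / Num.sqrt n%:R : R) @ \oo --> +oo.
Proof.
apply/cvgryPge => A; near=> n.
have n0 : (0 < n)%N by near: n; exists 1%N.
have sn0 : 0 < Num.sqrt n%:R :> R by rewrite sqrtr_gt0 ltr0n.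
rewrite ler_pdivlMr //.
have : 2 * A <= (2 ^ logscale n)%:R by near: n; apply: logscale_unbounded.
set k := ((2 ^ logscale n)%:R : R) => Ak.
have k0 : 0 < k by rewrite ltr0n expn_gt0.
have ks : k ^+ 2 <= Num.sqrt n%:R.
  rewrite -(ler_pXn2r (n := 2)) ?nnegrE ?exprn_ge0 ?(ltW k0) ?(ltW sn0) //.
  rewrite sqr_sqrtr ?ler0n //.
  by rewrite /k -exprM -natrX ler_nat logscale_bound.
have nd : Num.sqrt n%:R ^+ 2 <= 2 * (radius n)%:R * k.
  by rewrite sqr_sqrtr ?ler0n // -!natrM ler_nat radius_ge.
rewrite -(ler_pM2r k0).
set s := Num.sqrt _ in sn0 ks nd *; set d := (radius n)%:R in nd *.
have h1 : 0 <= (k - 2 * A) * (k * s).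
  by rewrite mulr_ge0 ?subr_ge0 // mulr_ge0 // ltW.
have h2 : 0 <= (s - k ^+ 2) * s by rewrite mulr_ge0 ?subr_ge0 // ltW.
by lra.
Unshelve. all: by end_near.
Qed.

(** Here [d / n <= 1 / k]. *)
Lemma cvg_radius_div (R : realType) :
  (fun n : nat => (radius n)%:R / n%:R : R) @ \oo --> (0 : R).
Proof.
apply/cvgr0Pnorm_le => e e0; near=> n.
have n0 : (0 < n)%N by near: n; exists 1%N.
rewrite ger0_norm ?divr_ge0 ?ler0n // ler_pdivrMr ?ltr0n //.
have ek : e^-1 <= (2 ^ logscale n)%:R by near: n; apply: logscale_unbounded.
have := radius_le n; rewrite -(ler_nat R) natrM => /(ler_wpM2l (ltW e0)).
apply: le_trans; rewrite mulrCA ler_peMr ?ler0n //.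
by rewrite -ler_pdivrMl // mulr1.
Unshelve. all: by end_near.
Qed.

(* Outside the range of the construction [r_n = n], and [S_r] is everything. *)
Definition threshold (n : nat) : nat :=
  if (242 * radius n <= n)%N then (n - radius n).-1 else n.

(** * The sublevel sets and the counterexample *)

Lemma sum_sublevel_nonzero_ind (R : realType) (n m : nat) :
  sum_sublevel (@nonzero_ind R) n m%:R = wt_ball n m.
Proof. by apply/setP => a; rewrite !inE -natr_sum ler_nat. Qed.

Lemma card_threshold_half (n : nat) : (0 < n)%N ->
  (3 ^ n <= 2 * #|wt_ball n (threshold n)|)%N.
Proof.
move=> n0; have d0 := radius_gt0 n0; rewrite /threshold.
case: ifP => [dn|_].
  have := @card_wt_co_ball_half n (radius n).
  rewrite (_ : [set a | _]%SET = (~: wt_ball n (n - radius n).-1)%SET).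
    have := cardsC (wt_ball n (n - radius n).-1); rewrite card_pow_vertices.
    by lia.
  by apply/setP => a; rewrite !inE; lia.
rewrite (_ : wt_ball n n = [set: _]%SET); last first.
  by apply/setP => a; rewrite !inE wt_le.
by rewrite cardsT card_pow_vertices leq_pmull.
Qed.

Theorem theorem2p19 (R : realType) :
  exists (T : finType) (e : rel T) (X : T -> R) (d : nat -> nat) (r : nat -> R),
    [/\ simple_graph e, connected_graph e & variance_optimal e X] /\
    (forall n : nat, (1 <= n)%N -> (0 < d n)%N) /\
    (fun n : nat => (d n)%:R / Num.sqrt n%:R : R) @ \oo --> +oo /\
    (fun n : nat => (d n)%:R / n%:R : R) @ \oo --> (0 : R) /\
    (forall n : nat, (1 <= n)%N ->
       2^-1 * #|pow_vertices T n|%:R <= #|sum_sublevel X n (r n)|%:R :> R) /\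
    (forall N : nat, exists n : nat, (N < n)%N /\
       exists S' : {set pow_vertices T n},
         (#|sum_sublevel X n (r n)| <= #|S'|)%N /\
         (#|pow_ball e (d n) S'| < #|pow_ball e (d n) (sum_sublevel X n (r n))|)%N).
Proof.
exists 'I_3, (@complete_rel _), (@nonzero_ind R), radius,
  (fun n => (threshold n)%:R).
split.
  split; [exact: simple_complete | | exact: variance_optimal_nonzero_ind].
  by split=> [|u v]; [rewrite card_ord | exact: connect_complete].
split; first exact: radius_gt0.
split; first exact: cvg_radius_sqrt.
split; first exact: cvg_radius_div.
split=> [n n0|N].
  rewrite sum_sublevel_nonzero_ind card_pow_vertices ler_pdivrMl ?ltr0n //.
  by rewrite -natrM ler_nat card_threshold_half.
(* The exponent makes [n > N] and [2 ^ logscale n >= 2^8 = 256 >= 242]. *)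
pose n := (16 ^ (N + 8))%N.
have Nn : (N + 8 < n)%N by exact: ltn_expl.
have n0 : (0 < n)%N by lia.
have d0 := radius_gt0 n0.
have dn : (242 * radius n <= n)%N.
  rewrite mulnC; apply: leq_trans (radius_le n); rewrite leq_mul2l.
  apply/orP; right; apply: (@leq_trans (2 ^ 8)) => //.
  by rewrite leq_exp2l //; have := @logscale_ge (N + 8) n (leqnn _); lia.
exists n; split; first by lia.
have [S' [leS ltB]] := exists_small_expansion d0 dn.
exists S'; rewrite sum_sublevel_nonzero_ind /threshold dn; split.
  apply: leq_trans leS; apply: subset_leq_card; apply/fintype.subsetP => a.
  by rewrite !inE; lia.
(* After adding [2^n], the two sides are separated by [3^n]. *)
rewrite -(ltn_add2r (2 ^ n)); apply: leq_trans ltB _.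
apply: pow_ball_sublevel => [|a]; first by lia.
by rewrite inE; lia.
Qed.
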